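(* Let $G_{\mathrm{puz}}$ range over a sequence of finite connected graphs whose number of vertices $N$ tends to infinity, let $D$ (which may depend on $N$) be the maximum degree of $G_{\mathrm{puz}}$, and consider the AE jigsaw percolation dynamics ($\sigma=\tau=1$, $\theta=\infty$). If $p=\mu/(D\log N)$ for a constant $\mu\le 1/30$, then $\mathbb{P}_p(\mathrm{Solve})\to 0$ as $N\to\infty$.
   Context: Setting. $G_{\mathrm{puz}}=(V,E_{\mathrm{puz}})$ (the puzzle graph) is a finite connected deterministic graph with $N=|V|$ vertices. $G_{\mathrm{ppl}}=(V,E_{\mathrm{ppl}})$ (the people graph) is the Erdős–Rényi random graph on the same vertex set: each unordered pair of distinct vertices is an edge independently with probability $p$ (which may depend on $N$); $\mathbb{P}_p$ denotes its law. Two vertices $v_1,v_2$ are doubly connected if $\{v_1,v_2\}\in E_{\mathrm{ppl}}\cap E_{\mathrm{puz}}$. For $v\in V$, $S\subset V$, let $\mathrm{coll}(v,S)$ (resp. $\mathrm{link}(v,S)$) be the number of $G_{\mathrm{ppl}}$-neighbors (resp. $G_{\mathrm{puz}}$-neighbors) of $v$ in $S$, not including $v$. Jigsaw percolation with parameters $\sigma\ge1$, $\tau\ge1$, $\theta\ge\tau$ ($\theta=\infty$ allowed) is the following discrete-time dynamics on partitions $\mathcal{P}^t=\{W_i^t\}$ of $V$. Given $\mathcal{P}^t$, let $\mathcal{G}_t$ be the graph with vertex set $\mathcal{P}^t$ and unoriented edges between distinct $W_i^t$ and $W_j^t$ such that, for some ordering of the two, at least one of the following holds: (J1) there are doubly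 connected $v_1\in W_i^t$, $v_2\in W_j^t$; (J2) there is $v_1\in W_i^t$ with $\mathrm{link}(v_1,W_j^t)\ge\theta$; (J3) there is $v_1\in W_i^t$ with $\mathrm{coll}(v_1,W_j^t)\ge\sigma$ and $\mathrm{link}(v_1,W_j^t)\ge\tau$. Then $\mathcal{P}^{t+1}$ is obtained by merging all sets of $\mathcal{P}^t$ that lie in the same connected component of $\mathcal{G}_t$. $\mathrm{Solve}$ is the event that, starting from $\mathcal{P}^0$ consisting of all singletons, $\mathcal{P}^t=\{V\}$ for some $t$. AE (adjacent-edge) dynamics is the case $\sigma=\tau=1$, $\theta=\infty$. *)

(* Defs.v *)
From mathcomp Require Import all_boot all_order all_algebra.
From mathcomp Require Import all_classical all_reals all_analysis.

Set Implicit Arguments.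
Unset Strict Implicit.
Unset Printing Implicit Defensive.
Import Order.TTheory GRing.Theory Num.Theory.

(* A graph on the vertex set V is given by its edge set; edges are unordered
   pairs, i.e. subsets of V with exactly two elements. *)
Definition all_pairs (V : finType) : {set {set V}} := [set e : {set V} | #|e| == 2].

Definition simple_graph (V : finType) (E : {set {set V}}) : bool :=
  E \subset all_pairs V.

Definition adj (V : finType) (E : {set {set V}}) : rel V :=
  fun u v => [set u; v] \in E.

Definition connected_graph (V : finType) (E : {set {set V}}) : Prop :=
  forall u v : V, connect (adj E) u v.

Definition max_degree (V : finType) (E : {set {set V}}) : nat :=
  \max_(v : V) #|[set u | adj E v u]|.

(* coll(v, S) for E the people graph, link(v, S) for E the puzzle graph. *)
Definition nbr_count (V : finType) (E : {set {set V}}) (v : V) (S : {set V})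
    : nat :=
  #|[set u in S :\ v | adj E v u]|.

(* The threshold theta is an extended natural number: None is infinity, and no
   (finite) link count reaches it. *)
Definition reaches (theta : option nat) (n : nat) : bool :=
  if theta is Some k then k <= n else false.

Definition J1 (V : finType) (Epuz Eppl : {set {set V}}) (A B : {set V}) : bool :=
  [exists v1 in A, exists v2 in B, [set v1; v2] \in Eppl :&: Epuz].

Definition J2 (theta : option nat) (V : finType) (Epuz : {set {set V}})
    (A B : {set V}) : bool :=
  [exists v1 in A, reaches theta (nbr_count Epuz v1 B)].

Definition J3 (sigma tau : nat) (V : finType) (Epuz Eppl : {set {set V}})
    (A B : {set V}) : bool :=
  [exists v1 in A,
    (sigma <= nbr_count Eppl v1 B) && (tau <= nbr_count Epuz v1 B)].

(* P is the current partition; sets outside P are isolated vertices. *)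
Definition merge_rel (sigma tau : nat) (theta : option nat) (V : finType)
    (Epuz Eppl : {set {set V}}) (P : {set {set V}}) : rel {set V} :=
  let J A B :=
    [|| J1 Epuz Eppl A B, J2 theta Epuz A B | J3 sigma tau Epuz Eppl A B] in
  fun A B => [&& A \in P, B \in P, A != B & J A B || J B A].

Definition jigsaw_step (sigma tau : nat) (theta : option nat) (V : finType)
    (Epuz Eppl : {set {set V}}) (P : {set {set V}}) : {set {set V}} :=
  [set \bigcup_(B in P |
         connect (merge_rel sigma tau theta Epuz Eppl P) A B) B | A in P].

Definition jigsaw_partition (sigma tau : nat) (theta : option nat)
    (V : finType) (Epuz Eppl : {set {set V}}) (t : nat) : {set {set V}} :=
  iter t (jigsaw_step sigma tau theta Epuz Eppl) [set [set v] | v : V].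

Definition Solve (sigma tau : nat) (theta : option nat) (V : finType)
    (Epuz : {set {set V}}) : set {set {set V}} :=
  [set Eppl | exists t : nat,
     jigsaw_partition sigma tau theta Epuz Eppl t = [set [set: V]]%SET]%classic.

Definition Solve_AE (V : finType) (Epuz : {set {set V}}) : set {set {set V}} :=
  Solve 1 1 None Epuz.

Local Open Scope ring_scope.

(* The Erdos-Renyi law P_p: each unordered pair of distinct vertices is an edge
   independently with probability p. This is a probability law when
   0 <= p <= 1. *)
Definition ER_weight (R : realType) (p : R) (V : finType)
    (E : {set {set V}}) : R :=
  \prod_(e in all_pairs V) bernoulli_pmf p (e \in E).

Definition ER_prob (R : realType) (p : R) (V : finType)
    (A : set {set {set V}}) : R :=
  \sum_(E : {set {set V}} | simple_graph E && (E \in A)) ER_weight p E.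

(* Main.v *)
(* First moment at the nucleation scale. Call S doubly connected if both graphs
   induce connected graphs on S. Two merging clusters have a doubly connected
   union, so if the puzzle is solved then, for every 2 <= m <= N, some doubly
   connected S has m <= |S| < 2m. A connected people graph on S (|S| = k)
   contains a tree, given by one of at most k^(k-1) parent maps, hence occurs
   with probability at most (k p)^(k-1). Comparison with site percolation of
   density 1/D shows that at most N D^(k-1) e^k sets of size k are connected in
   the puzzle graph. The expected number of doubly connected sets of size k is
   thus at most N e (e k D p)^(k-1). For m = floor (ln N) and k < 2m we have
   e k D p <= 2 e mu <= 2/9 and N <= (10/3)^(m+1), so that the sum over
   m <= k < 2m decays like m (20/27)^m. *)

Require Import Defs.
From mathcomp Require Import all_boot all_order all_algebra.
From mathcomp Require Import all_classical all_reals all_analysis.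
From mathcomp Require Import lra ring.
Import Order.TTheory GRing.Theory Num.Theory.
Import numFieldNormedType.Exports.
Set Implicit Arguments.
Unset Strict Implicit.
Unset Printing Implicit Defensive.

(** * Connectivity of induced subgraphs *)

Section InducedConnectivity.
Variables (V : finType) (E : {set {set V}}).
Implicit Types S T : {set V}.

Definition induced S : rel V :=
  fun u v => [&& u \in S, v \in S & adj E u v].

Definition connected_in S : bool :=
  [forall u in S, forall v in S, connect (induced S) u v].

Lemma adj_sym : symmetric (adj E).
Proof. by move=> u v; rewrite /adj finset.setUC. Qed.

Lemma induced_sym S : symmetric (induced S).
Proof. by move=> u v; rewrite /induced adj_sym andbCA. Qed.

Lemma connected_inP S :
  reflect {in S &, forall u v, connect (induced S) u v} (connected_in S).
Proof.
apply: (iffP forall_inP) => [h u v uS vS|h u uS].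
  by move/forall_inP: (h u uS); apply.
by apply/forall_inP => v; apply: h.
Qed.

Lemma sub_connect_induced S T u v :
  S \subset T -> connect (induced S) u v -> connect (induced T) u v.
Proof.
move=> /fintype.subsetP sST; apply: connect_sub => x y /and3P[xS yS xy].
by apply: connect1; rewrite /induced !sST.
Qed.

Lemma connect_induced_mem S u v : connect (induced S) u v -> u \in S -> v \in S.
Proof.
move=> /connectP[p + ->]; elim: p u => //= w p IHp u /andP[/and3P[_ wS _] pth] _.
exact: IHp.
Qed.

Lemma connected_in1 v : connected_in [set v]%SET.
Proof. by apply/connected_inP => u w /set1P-> /set1P->; apply: connect0. Qed.

Lemma connected_inU S T v w :
  connected_in S -> connected_in T -> v \in S -> w \in T -> adj E v w ->
  connected_in (S :|: T).
Proof.
move=> /connected_inP cS /connected_inP cT vS wT vw.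
have sym := sym_connect_sym (@induced_sym (S :|: T)).
have vwU : connect (induced (S :|: T)) v w.
  by apply: connect1; rewrite /induced !inE vS wT orbT.
suff toV x : x \in S :|: T -> connect (induced (S :|: T)) v x.
  by apply/connected_inP => x y /toV vx /toV; apply: connect_trans; rewrite sym.
case/setUP => [xS|xT].
  exact: sub_connect_induced (finset.subsetUl S T) (cS _ _ vS xS).
apply: (connect_trans vwU).
exact: sub_connect_induced (finset.subsetUr S T) (cT _ _ wT xT).
Qed.

(** A path inside [S] from [r] to a point outside [T] has a first step leaving [T]. *)
Lemma connected_in_crossing S T r :
  connected_in S -> r \in T -> T \proper S ->
  exists u v, [/\ u \in T, v \in S :\: T & adj E u v].
Proof.
move=> /connected_inP cS rT /properP[/fintype.subsetP sTS [x xS xT]].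
have /connectP[p] := cS _ _ (sTS _ rT) xS.
elim: p r rT => [|y p IHp] r rT /= => [_ xr|/andP[/and3P[_ yS ry] pth] xl].
  by rewrite xr rT in xT.
have [yT|yT] := boolP (y \in T); first exact: (IHp y).
by exists r, y; rewrite rT inE yT yS.
Qed.

End InducedConnectivity.

(** * Deterministic nucleation of doubly connected sets *)

Section Nucleation.
Variables (V : finType) (Epuz Eppl : {set {set V}}).
Implicit Types S T : {set V}.

Definition doubly_connected_in S : bool :=
  connected_in Epuz S && connected_in Eppl S.

(** J2 never fires when theta is infinite, while J1 and J3 each supply one edge of either graph.
    Under J3 the two edges may end at different vertices of [B], hence the separate witnesses. *)
Lemma J13_edges (A B : {set V}) :
  [|| J1 Epuz Eppl A B, J2 None Epuz A B | J3 1 1 Epuz Eppl A B] ->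
  (exists2 v, v \in A & exists2 w, w \in B & adj Epuz v w) /\
  (exists2 v, v \in A & exists2 w, w \in B & adj Eppl v w).
Proof.
case/or3P => [/exists_inP[v vA /exists_inP[w wB]]||].
- by rewrite inE => /andP[ppl puz]; split; exists v => //; exists w.
- by case/exists_inP.
case/exists_inP => v vA /andP[/card_gt0P[x] + /card_gt0P[y]].
rewrite !inE => /andP[/andP[_ xB] vx] /andP[/andP[_ yB] vy].
by split; exists v => //; [exists y|exists x].
Qed.

Lemma doubly_connected_in_merge (P : {set {set V}}) (A B S T : {set V}) :
  merge_rel 1 1 None Epuz Eppl P A B -> A \subset S -> B \subset T ->
  doubly_connected_in S -> doubly_connected_in T ->
  doubly_connected_in (S :|: T).
Proof.
move=> /and4P[_ _ _ J] + + /andP[zS lS] /andP[zT lT].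
wlog : A B S T zS lS zT lT J /
    [|| J1 Epuz Eppl A B, J2 None Epuz A B | J3 1 1 Epuz Eppl A B].
  move=> wl AS BT; case/orP: (J) => J'; first exact: (wl A B).
  by rewrite finset.setUC; apply: (wl B A) => //; rewrite orbC.
move=> /J13_edges[[v vA [w wB vw]] [v' vA' [w' wB' vw']]].
move=> /fintype.subsetP AS /fintype.subsetP BT.
by apply/andP; split; [apply: (@connected_inU _ _ _ _ v w)
                      |apply: (@connected_inU _ _ _ _ v' w')]; auto.
Qed.

(* Absent a doubly connected set of size in [m, 2m), the union of two merging
   doubly connected sets of size < m again has size < m; a maximal one therefore
   absorbs every block it meets, and all blocks stay small forever. *)
Lemma small_blocks (m t : nat) :
  (1 < m)%N ->
  (forall S, doubly_connected_in S -> ~~ (m <= #|S| < m.*2)%N) ->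
  forall A, A \in jigsaw_partition 1 1 None Epuz Eppl t ->
  exists S, [/\ doubly_connected_in S, (#|S| < m)%N & A \subset S].
Proof.
move=> m_gt1 gap; elim: t => [|t IHt] A.
  case/imsetP => v _ ->; exists [set v]%SET.
  by rewrite /doubly_connected_in !connected_in1 cards1.
rewrite /jigsaw_partition iterS => /imsetP[{}A AP ->].
set P := iter _ _ _ in AP *.
pose good S := [&& doubly_connected_in S, (#|S| < m)%N & A \subset S].
have [S0 [dS0 cS0 sS0]] := IHt _ AP.
have gS0 : good S0 by rewrite /good dS0 cS0.
have [S gS maxS] := @arg_maxnP _ S0 good (fun S => #|S|) gS0.
have /and3P[dS cS sS] := gS.
exists S; split=> //; apply/bigcupsP => B /andP[_ /connectP[p + ->]].
elim: p (A) AP sS => [|C p IHp] A' A'P A'S //= /andP[A'C].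
have CP : C \in P by case/and4P: A'C.
apply: (IHp _ CP) => //.
have [T [dT cT sT]] := IHt _ CP.
have dU := doubly_connected_in_merge A'C A'S sT dS dT.
have cU : (#|S :|: T| < m)%N.
  have := gap _ dU; rewrite negb_and -ltnNge => /orP[//|/negP[]].
  rewrite -addnn (leq_ltn_trans (leq_card_setU _ _)) //.
  by rewrite -addSn leq_add // ltnW.
have /eqP <- : S :|: T == S.
  rewrite eq_sym eqEcard finset.subsetUl; apply: maxS.
  rewrite /good dU cU (fintype.subset_trans _ (finset.subsetUl S T)) //.
  by case/and3P: gS.
exact: fintype.subset_trans sT (finset.subsetUr S T).
Qed.

(** If the window [m, 2m) were empty, every block would fit in a set of size < m forever, but the
    final block is all of [V]. *)
Lemma Solve_AE_nucleus (m : nat) :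
  (1 < m <= #|V|)%N -> (Eppl \in Solve_AE Epuz) ->
  exists2 S, doubly_connected_in S & (m <= #|S| < m.*2)%N.
Proof.
move=> /andP[m_gt1 m_le] /set_mem[t Pt].
have [/exists_inP[S]|] :=
  boolP [exists S in [pred S | doubly_connected_in S], (m <= #|S| < m.*2)%N].
  by exists S.
move=> /exists_inPn gap.
have [|S [_ cS sS]] := @small_blocks m t m_gt1 gap [set: V]%SET.
  by rewrite Pt inE.
have := leq_trans cS m_le; rewrite ltnNge -cardsT.
by rewrite subset_leq_card.
Qed.

End Nucleation.

Local Open Scope ring_scope.

(** * Union bound and cylinder probabilities of Bernoulli sets *)

Lemma ler_sum_cover (R : realDomainType) (X I : finType) (P : pred X)
    (Q : pred I) (P' : I -> pred X) (w : X -> R) :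
  (forall x, 0 <= w x) -> (forall x, P x -> exists2 i, Q i & P' i x) ->
  \sum_(x | P x) w x <= \sum_(i | Q i) \sum_(x | P' i x) w x.
Proof.
move=> w_ge0 cover.
rewrite (exchange_big_dep xpredT) //= big_mkcond /=; apply: ler_sum => x _.
case: ifP => [/cover[i Qi P'i]|_]; last by apply: sumr_ge0.
by rewrite (bigD1 i) ?Qi //= lerDl sumr_ge0.
Qed.

Lemma bernoulli_cylinder (R : realType) (X : finType) (q : R)
    (T O C : {set X}) :
  O \subset T -> C \subset T -> [disjoint O & C] ->
  \sum_(J : {set X} | [&& J \subset T, O \subset J & [disjoint C & J]])
     \prod_(i in T) bernoulli_pmf q (i \in J) = q ^+ #|O| * (1 - q) ^+ #|C|.
Proof.
move=> /fintype.subsetP OT /fintype.subsetP CT /disjointFr OC.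
(* [F i] and [G i] weigh the choices of i inside and outside [J]; their zeros kill every [J]
   violating a constraint. By distributivity the sum becomes the product of the [F i + G i], which
   are q on [O], 1 - q on [C] and 1 elsewhere. *)
pose F i := if (i \in T) && (i \notin C) then q else 0.
pose G i := if i \in O then 0 else if i \in T then 1 - q else 1.
transitivity (\sum_(J : {set X}) \prod_i (if i \in J then F i else G i)).
  rewrite big_mkcond /=; apply: eq_bigr => J _.
  case: ifPn => [/and3P[/fintype.subsetP JT /fintype.subsetP OJ]|].
    move=> /disjointFr CJ; rewrite big_mkcond /=; apply: eq_bigr => i _.
    rewrite /bernoulli_pmf /F /G; case: ifP => iT; case: ifPn => iJ //=.
    - by rewrite ifT //; apply/negP => /CJ; rewrite iJ.
    - by rewrite ifN //; apply: contra iJ; apply: OJ.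
    - by rewrite JT in iT.
    - by rewrite ifN //; apply/negP => /OJ; rewrite (negbTE iJ).
  move=> badJ; apply/esym/eqP/prodf_eq0.
  case/nandP: badJ => [/subsetPn[i iJ iT]|/nandP[/subsetPn[i iO iJ]|CJ]].
  - by exists i; rewrite // iJ /F (negbTE iT).
  - by exists i; rewrite // (negbTE iJ) /G iO.
  - case/pred0Pn: CJ => i /andP[/= iC iJ].
    by exists i; rewrite // iJ /F iC andbF.
rewrite -bigA_distr -!prodr_const.
rewrite [X in _ = X * _]big_mkcond [X in _ = _ * X]big_mkcond -big_split /=.
apply: eq_bigr => i _; rewrite /F /G.
have [iO|iO] := boolP (i \in O).
  by rewrite OT // OC // addr0 mulr1.
have [iC|iC] := boolP (i \in C); first by rewrite CT // add0r mul1r.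
by case: (i \in T); rewrite /= ?add0r ?mulr1 // addrC subrK.
Qed.

(** * Probability that the people graph connects a given set *)

Section ErdosRenyi.
Variables (R : realType) (p : R) (V : finType).
Hypothesis p01 : 0 <= p <= 1.
Implicit Types (S : {set V}) (E F : {set {set V}}).

Lemma ER_weight_ge0 E : 0 <= ER_weight p E.
Proof. by apply: prodr_ge0 => e _; apply: bernoulli_pmf_ge0. Qed.

Lemma ER_supset F : F \subset all_pairs V ->
  \sum_(E | simple_graph E && (F \subset E)) ER_weight p E = p ^+ #|F|.
Proof.
move=> sF.
have -> : p ^+ #|F| = p ^+ #|F| * (1 - p) ^+ #|(finset.set0 : {set {set V}})|.
  by rewrite cards0 mulr1.
rewrite -(@bernoulli_cylinder _ _ _ (all_pairs V)) ?finset.sub0set //; last first.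
  by rewrite disjoint_sym finset.disjoints_subset finset.sub0set.
by apply: eq_bigl => E; rewrite finset.disjoints_subset finset.sub0set andbT.
Qed.

(** The map sends each vertex to its parent in a spanning tree rooted at [r], grown by one crossing
    edge at a time. Injectivity records that the tree has |S| - 1 distinct edges, which fixes the
    power of p later. *)
Lemma connected_in_parent E S r : connected_in E S -> r \in S ->
  exists f : {ffun V -> V},
    [/\ f \in pffun_on r (mem (S :\ r)) (mem S),
        {in S :\ r, forall v, [set v; f v]%SET \in E}
      & {in S :\ r &, injective (fun v => [set v; f v]%SET)}].
Proof.
move=> cS rS.
suff [f [fS fE fI]] : exists f : V -> V,
    [/\ {in S :\ r, forall v, f v \in S},
        {in S :\ r, forall v, [set v; f v]%SET \in E}
      & {in S :\ r &, injective (fun v => [set v; f v]%SET)}].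
  (* Off [S :\ r] the map is reset to the default [r], as membership in [pffun_on r] demands; this
     makes the family of maps countable as k^(k-1). *)
  have fD v : v \in S :\ r -> [ffun v => if v \in S :\ r then f v else r] v = f v.
    by rewrite ffunE => ->.
  exists [ffun v => if v \in S :\ r then f v else r]; split.
  - apply/pfamilyP; split; last by move=> v vS; rewrite fD //; apply: fS.
    by apply/finfun.supportP => v vS; rewrite ffunE (negbTE vS).
  - by move=> v vS; rewrite fD //; apply: fE.
  - by move=> v w vS wS; rewrite !fD //; apply: fI.
suff grow n : (n < #|S|)%N -> exists (T : {set V}) (f : V -> V),
    [/\ r \in T, T \subset S, #|T| = n.+1
      & [/\ {in T :\ r, forall v, f v \in T},
        {in T :\ r, forall v, [set v; f v]%SET \in E}
      & {in T :\ r &, injective (fun v => [set v; f v]%SET)}]].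
  have S_gt0 : (0 < #|S|)%N by apply/card_gt0P; exists r.
  have [|T [f [_ TS cT]]] := grow #|S|.-1; first by rewrite ltn_predL.
  have -> : T = S by apply/eqP; rewrite eqEcard TS cT prednK //=.
  by exists f.
elim: n => [_|n IHn n_lt].
  exists [set r]%SET, id; rewrite finset.sub1set cards1 set11.
  by split=> //; split=> v; rewrite !inE andNb.
have [T [f [rT TS cT [fT fE fI]]]] := IHn (ltnW n_lt).
have ltTS : T \proper S by rewrite properEcard TS cT.
have [u [v [uT /setDP[vS vT] uv]]] := connected_in_crossing cS rT ltTS.
have vNT x : x \in T -> (x == v) = false.
  by move=> xT; apply/negP => /eqP xv; rewrite -xv xT in vT.
exists (v |: T), (fun x => if x == v then u else f x).
rewrite !inE rT orbT finset.subUset finset.sub1set vS cardsU1 vT cT.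
have split_vT x : x \in (v |: T) :\ r -> x = v \/ x \in T :\ r.
  by rewrite !inE => /andP[xr /orP[/eqP|xT]]; [left|right; rewrite xr].
(* Earlier edges lie inside [T], whereas the added one contains [v] outside [T]. *)
have new x : x \in T :\ r -> [set x; f x]%SET <> [set v; u]%SET.
  move=> xT /setP/(_ v); rewrite !inE eqxx /= !(eq_sym v) !vNT //.
  - exact: fT.
  - by case/setD1P: xT.
split=> //; split.
- move=> x /split_vT[->|xT]; first by rewrite eqxx !inE uT orbT.
  by rewrite vNT ?inE ?fT ?orbT //; case/setD1P: xT.
- move=> x /split_vT[->|xT]; first by rewrite eqxx finset.setUC.
  by rewrite vNT ?fE //; case/setD1P: xT.
- have inT x : x \in T :\ r -> x \in T by case/setD1P.
  move=> x y /split_vT[->|xT] /split_vT[->|yT] //; rewrite ?eqxx ?vNT ?inT //.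
  + by move=> /esym /new; case.
  + by move=> /new; case.
  + exact: fI.
Qed.

Lemma ER_connected_in_le S : (0 < #|S|)%N ->
  \sum_(E | simple_graph E && connected_in E S) ER_weight p E
    <= (#|S|%:R * p) ^+ #|S|.-1.
Proof.
case/card_gt0P => r rS; have cS : #|S :\ r| = #|S|.-1 by rewrite (cardsD1 r S) rS.
have [p_ge0 _] := andP p01.
pose edges (f : {ffun V -> V}) := [set [set v; f v] | v in S :\ r]%SET.
(* Only maps with |S| - 1 genuine, distinct edges enter the union bound, so that each contributes
   exactly p^(|S|-1); the final count then admits all maps. *)
pose Q (f : {ffun V -> V}) := [&& f \in pffun_on r (mem (S :\ r)) (mem S),
  edges f \subset all_pairs V & #|edges f| == #|S|.-1].
apply: (le_trans (@ler_sum_cover _ _ _ _ Q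
  (fun f E => simple_graph E && (edges f \subset E)) _ ER_weight_ge0 _)).
  move=> E /andP[sE /connected_in_parent /(_ rS)[f [fS fE fI]]].
  have sfE : edges f \subset E.
    by apply/fintype.subsetP => _ /imsetP[v vS ->]; apply: fE.
  exists f; last by rewrite sE.
  by rewrite /Q fS (fintype.subset_trans sfE sE) card_in_imset ?cS /=.
under eq_bigr => f /and3P[_ sf /eqP cf] do rewrite ER_supset // cf.
rewrite exprMn -natrX -cS -(card_pffun_on r) mulr_natl -sumr_const.
rewrite big_mkcond [leRHS]big_mkcond /=; apply: ler_sum => f _.
rewrite /Q; have [fS|//] := boolP (f \in pffun_on _ _ _).
by case: ifP => // _; rewrite exprn_ge0.
Qed.

End ErdosRenyi.

(** * Connected sets as clusters of site percolation *)

Section LatticeAnimals.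
Variables (V : finType) (E : {set {set V}}).
Implicit Types (S A : {set V}).

Definition outer_boundary S : {set V} :=
  [set w | (w \notin S) && [exists u in S, adj E u w]].

(** A path in [A] cannot leave [S], since its first vertex outside would lie in the outer boundary,
    which misses [A]. Thus [S] is the open cluster of [v] and is determined by [A]. *)
Lemma cluster_unique S A v u : connected_in E S -> v \in S -> S \subset A ->
  [disjoint outer_boundary S & A] -> (u \in S) = connect (induced E A) v u.
Proof.
move=> /connected_inP cS vS SA /disjointFr bA; apply/idP/idP => [uS|].
  exact: sub_connect_induced SA (cS _ _ vS uS).
move=> /connectP[s + ->]; elim: s v vS => //= w s IHs v vS /andP[/and3P[_ wA vw]].
apply: IHs; apply/negPn/negP => wS; rewrite bA // in wA.
by rewrite inE wS; apply/exists_inP; exists v.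
Qed.

(* The S-term is the probability that the open cluster of v is S in site
   percolation with density q; these events are disjoint and force v to be
   open. *)
Lemma cluster_sum_le (R : realType) (q : R) v : 0 <= q <= 1 ->
  \sum_(S | connected_in E S && (v \in S))
     q ^+ #|S| * (1 - q) ^+ #|outer_boundary S| <= q.
Proof.
move=> q01.
under eq_bigr => S _.
  rewrite -(@bernoulli_cylinder _ _ _ [set: V]) ?finset.subsetT //; first over.
  by rewrite finset.disjoints_subset; apply/fintype.subsetP => w wS; rewrite !inE wS.
(* Reading q as the probability that [v] is open allows a comparison configuration by
   configuration. *)
have -> : q = q ^+ #|[set v]%SET| * (1 - q) ^+ #|(finset.set0 : {set V})|.
  by rewrite cards1 cards0 mulr1.
rewrite -[leRHS](@bernoulli_cylinder _ _ _ [set: V]) ?finset.subsetT //; last first.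
  by rewrite disjoint_sym finset.disjoints_subset finset.sub0set.
rewrite cards1 cards0 mulr1 expr1.
rewrite (exchange_big_dep xpredT) //= [leRHS]big_mkcond /=.
apply: ler_sum => A _; set w := \prod_(i in _) _.
have w_ge0 : 0 <= w by apply: prodr_ge0 => i _; apply: bernoulli_pmf_ge0.
rewrite finset.subsetT finset.disjoints_subset finset.sub0set andbT finset.sub1set /=.
have [S0|] := pickP (fun S => [&& connected_in E S && (v \in S), S \subset A
  & [disjoint outer_boundary S & A]]); last first.
  by move=> none; rewrite big_pred0 //; case: ifP.
case/and3P => /andP[cS0 vS0] sS0 dS0.
rewrite (fintype.subsetP sS0) // (big_pred1 S0) // => S; apply/idP/eqP.
  case/and3P => /andP[cS vS] sS dS; apply/setP => u.
  by rewrite (cluster_unique u cS vS sS dS) (cluster_unique u cS0 vS0 sS0 dS0).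
by move=> ->; rewrite cS0 vS0 sS0.
Qed.

(** Each vertex of [S] has a neighbor inside [S], which leaves at most D - 1 neighbors outside. *)
Lemma card_outer_boundary_le S : connected_in E S -> (1 < #|S|)%N ->
  (#|outer_boundary S| <= (max_degree E).-1 * #|S|)%N.
Proof.
move=> cS S_gt1.
have sub : outer_boundary S \subset
    \bigcup_(u in S) ([set w | adj E u w] :\: S)%SET.
  apply/fintype.subsetP => w; rewrite inE => /andP[wS /exists_inP[u uS uw]].
  by apply/bigcupP; exists u; rewrite // !inE wS.
apply: (leq_trans (subset_leq_card sub)).
apply: (@leq_trans (\sum_(u in S) #|[set w | adj E u w] :\: S|)).
  elim/big_ind2: _ => [|A m B n Am Bn|//]; first by rewrite cards0.
  exact: leq_trans (leq_card_setU _ _) (leq_add Am Bn).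
rewrite mulnC -sum_nat_const; apply: leq_sum => u uS.
have ltS : [set u]%SET \proper S by rewrite properEcard finset.sub1set uS cards1.
have [_ [v [/set1P-> /setDP[vS _] uv]]] := connected_in_crossing cS (set11 u) ltS.
rewrite -ltnS (leq_trans _ (leqSpred _)) //.
apply: (leq_trans _ (leq_bigmax u)); apply: proper_card.
apply/properP; split; first exact: finset.subsetDl.
by exists v; rewrite !inE ?uv ?vS.
Qed.

End LatticeAnimals.

(** * Numerical estimates *)

Section Estimates.
Variable R : realType.

Lemma expR1_le : expR 1 <= 10%:R / 3%:R :> R.
Proof.
(* From 1 - 1/4 <= e^(-1/4); the fourth power 256/81 is below 10/3. *)
have h : expR (4%:R^-1) <= 4%:R / 3%:R :> R.
  have := ler_wpM2r (expR_ge0 (4%:R^-1 : R)) (expR_ge1Dx (- 4%:R^-1)).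
  by rewrite expRN mulVf ?gt_eqF ?expR_gt0 //; lra.
have -> : 1 = 4%:R * 4%:R^-1 :> R by lra.
rewrite expRM_natl.
apply: (le_trans (lerXn2r 4 _ _ h)); rewrite ?nnegrE ?expR_ge0 //; lra.
Qed.

(** For D > 1, 1 - 1/D is the inverse of 1 + 1/(D-1), whose power D - 1 is at most e. *)
Lemma expRN1_le_pow (D : nat) : (0 < D)%N ->
  expR (- 1) <= (1 - D%:R^-1) ^+ D.-1 :> R.
Proof.
case: D => // -[_|d _]; first by rewrite expr0 -[leRHS]expR0 ler_expR lerN10.
have -> : 1 - d.+2%:R^-1 = (1 + d.+1%:R^-1)^-1 :> R.
  have -> : d.+2%:R = 1 + d.+1%:R :> R by rewrite -natr1 addrC.
  have : 0 < d.+1%:R :> R by rewrite ltr0n.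
  by move: (d.+1%:R) => x x0; field; rewrite ?addr_eq0; apply/andP; split; lra.
rewrite exprVn expRN lef_pV2 ?posrE ?expR_gt0 ?exprn_gt0 ?addr_gt0 ?invr_gt0 //.
have -> : expR 1 = expR (d.+1%:R * d.+1%:R^-1) :> R.
  by rewrite divff // pnatr_eq0.
by rewrite expRM_natl lerXn2r ?nnegrE ?expR_ge0 ?addr_ge0 ?invr_ge0 ?expR_ge1Dx.
Qed.

Lemma natrM_expn_le (m : nat) : m%:R * (8%:R / 9%:R) ^+ m <= 8%:R :> R.
Proof.
(* The shift by 8 makes the sequence nonincreasing from its initial value 8, as (9 + m) 8/9 <= 8 +
   m. *)
suff : (8%:R + m%:R) * (8%:R / 9%:R) ^+ m <= 8%:R :> R.
  apply: le_trans; rewrite ler_wpM2r ?lerDr // exprn_ge0 //; lra.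
elim: m => [|m]; first by rewrite addr0 expr0 mulr1.
apply: le_trans; rewrite exprS mulrA -[m.+1%:R]natr1 ler_wpM2r ?exprn_ge0 //.
by have := ler0n R m; lra.
Qed.

End Estimates.

(** * First moment of doubly connected sets *)

Section FirstMoment.
Variables (R : realType) (V : finType) (Epuz : {set {set V}}).
Let D := max_degree Epuz.
Hypothesis D_gt0 : (0 < D)%N.

(** At density q = 1/D every cluster term is at least (q/e)^k, because (1-q)^((D-1)k) >= e^(-k), and
    the terms sum to at most q. *)
Lemma card_connected_at_le (k : nat) (v : V) : (1 < k)%N ->
  (#|[set S | [&& connected_in Epuz S, v \in S & #|S| == k]]|)%:R
    <= D%:R ^+ k.-1 * expR 1 ^+ k :> R.
Proof.
move=> k_gt1; set A := [set S | _]; pose q : R := D%:R^-1.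
have Dr_ge1 : 1 <= D%:R :> R by rewrite ler1n.
have q_gt0 : 0 < q by rewrite invr_gt0 ltr0n.
have q_le1 : q <= 1 by rewrite invf_le1 // ltr0n.
have : #|A|%:R * (q ^+ k * expR (- 1) ^+ k) <= q.
  apply: le_trans (@cluster_sum_le _ Epuz R q v _); last by rewrite ltW.
  rewrite mulr_natl -sumr_const big_mkcond [leRHS]big_mkcond /=.
  apply: ler_sum => S _; rewrite inE.
  case: ifPn => [/and3P[cS vS /eqP kS]|_].
    rewrite cS vS kS ler_wpM2l ?exprn_ge0 ?(ltW q_gt0) //.
    apply: (@le_trans _ _ ((1 - q) ^+ (D.-1 * #|S|))).
      by rewrite kS exprM lerXn2r ?nnegrE ?expR_ge0 ?exprn_ge0 ?subr_ge0
        ?expRN1_le_pow.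
    rewrite ler_wiXn2l ?subr_ge0 ?gerBl ?(ltW q_gt0) //.
    by rewrite card_outer_boundary_le // kS.
  by case: ifP => // _; rewrite mulr_ge0 // exprn_ge0 ?subr_ge0 // ltW.
rewrite expRN -exprMn -ler_pdivlMr; last first.
  by rewrite exprn_gt0 // mulr_gt0 // invr_gt0 expR_gt0.
move=> /le_trans; apply.
have D_neq0 : D%:R != 0 :> R by rewrite pnatr_eq0 -lt0n.
rewrite -exprVn invf_div {2}/q invrK exprMn mulrCA mulrC.
rewrite ler_wpM2r ?exprn_ge0 ?expR_ge0 //.
by rewrite -[in leLHS](prednK (ltnW k_gt1)) exprS mulKf.
Qed.

Lemma card_connected_le (k : nat) : (1 < k)%N ->
  (#|[set S | connected_in Epuz S && (#|S| == k)]|)%:R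
    <= #|V|%:R * (D%:R ^+ k.-1 * expR 1 ^+ k) :> R.
Proof.
move=> k_gt1.
apply: (@le_trans _ _
  (\sum_(v : V) #|[set S | [&& connected_in Epuz S, v \in S & #|S| == k]]|%:R)).
  rewrite -natr_sum ler_nat.
  have sub : [set S | connected_in Epuz S && (#|S| == k)] \subset
      \bigcup_v [set S | [&& connected_in Epuz S, v \in S & #|S| == k]]%SET.
    apply/fintype.subsetP => S; rewrite inE => /andP[cS kS].
    have /card_gt0P[v vS] : (0 < #|S|)%N by rewrite (eqP kS) ltnW.
    by apply/bigcupP; exists v; rewrite // inE cS vS.
  apply: (leq_trans (subset_leq_card sub)).
  elim/big_ind2: _ => [|A a B b Aa Bb|//]; first by rewrite cards0.
  exact: leq_trans (leq_card_setU _ _) (leq_add Aa Bb).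
rewrite mulr_natl -sumr_const; apply: ler_sum => v _.
exact: card_connected_at_le.
Qed.

Lemma ER_Solve_AE_le (p : R) (m : nat) : 0 <= p <= 1 -> (1 < m <= #|V|)%N ->
  ER_prob p (Solve_AE Epuz) <=
  \sum_(k < m.*2 | (m <= k)%N)
     #|V|%:R * expR 1 * (expR 1 * (k%:R * (D%:R * p))) ^+ k.-1.
Proof.
move=> p01 m_gt1; have [p_ge0 _] := andP p01.
apply: (le_trans (@ler_sum_cover _ _ _ _
  (fun S => connected_in Epuz S && (m <= #|S| < m.*2)%N)
  (fun S E => simple_graph E && connected_in E S) _ (ER_weight_ge0 p01) _)).
  move=> E /andP[sE solveE].
  have [S /andP[cS lS] mS] := Solve_AE_nucleus m_gt1 solveE.
  by exists S; rewrite ?cS ?mS ?sE.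
apply: (@le_trans _ _
  (\sum_(S | connected_in Epuz S && (m <= #|S| < m.*2)%N)
     (#|S|%:R * p) ^+ #|S|.-1)).
  apply: ler_sum => S /and3P[_ mS _]; apply: ER_connected_in_le => //.
  by rewrite (leq_trans _ mS) // (leq_trans _ (proj1 (andP m_gt1))).
apply: (le_trans (@ler_sum_cover _ _ _ _ (fun k : 'I_m.*2 => (m <= k)%N)
  (fun k S => connected_in Epuz S && (#|S| == k)) _ _ _)).
- by move=> S; rewrite exprn_ge0 ?mulr_ge0.
- by move=> S /and3P[cS mS Sm]; exists (Ordinal Sm); rewrite ?cS /=.
apply: ler_sum => k mk.
have k_gt1 : (1 < k)%N by rewrite (leq_trans _ mk) //; case/andP: m_gt1.
rewrite (eq_bigr (fun=> (k%:R * p) ^+ k.-1)); last by move=> S /andP[_ /eqP->].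
rewrite sumr_const -[leLHS]mulr_natl -cardsE.
apply: (le_trans (ler_wpM2r _ (card_connected_le k_gt1))).
  by rewrite exprn_ge0 ?mulr_ge0.
have -> : expR 1 ^+ k = expR 1 * expR 1 ^+ k.-1 :> R.
  by rewrite -exprS prednK // ltnW.
by rewrite le_eqVlt; apply/orP; left; apply/eqP; rewrite !exprMn; ring.
Qed.

End FirstMoment.

(** * Choice of the scale and passage to the limit *)

Lemma max_degree_gt0 (V : finType) (E : {set {set V}}) :
  connected_graph E -> (1 < #|V|)%N -> (0 < max_degree E)%N.
Proof.
move=> conn /card_gt1P[u [v [_ _ uv]]].
have /connectP[[|w s] /=] := conn u v; first by move=> _ vu; rewrite vu eqxx in uv.
move=> /andP[uw _] _; apply: (leq_trans _ (leq_bigmax u)).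
by apply/card_gt0P; exists w; rewrite inE.
Qed.

Lemma ER_Solve_AE_le_geometric (R : realType) (V : finType)
    (E : {set {set V}}) (mu : R) :
  connected_graph E -> 0 <= mu <= 1 / 30%:R ->
  let m := Num.trunc (ln #|V|%:R : R) in (1 < m)%N ->
  0 <= ER_prob (mu / ((max_degree E)%:R * ln #|V|%:R)) (Solve_AE E)
    <= geometric 800%:R (5%:R / 6%:R) m.
Proof.
move=> conn /andP[mu_ge0 mu_le] m m_gt1.
pose L : R := ln #|V|%:R; pose D := max_degree E; rewrite -/L -/D.
have V_gt1 : (1 < #|V|)%N.
  rewrite ltnNge; apply/negP => V1; move: m_gt1.
  rewrite truncn_gt_nat; apply/negP; rewrite -ltNge (le_lt_trans (ln_le0 _)) //.
  by rewrite lern1.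
have D_ge1 : 1 <= D%:R :> R by rewrite ler1n max_degree_gt0.
have L_gt0 : 0 < L by rewrite ln_gt0 // ltr1n.
have /andP[m_le L_lt] := truncn_itv (ltW L_gt0); rewrite -/m in m_le L_lt.
have L_ge1 : 1 <= L by apply: le_trans m_le; rewrite ler1n ltnW.
have DL_ge1 : 1 <= D%:R * L by rewrite mulr_ege1.
have NE : #|V|%:R = expR L by rewrite lnK // posrE ltr0n ltnW.
set p := mu / _.
have Dp : D%:R * p = mu / L.
  by rewrite /p; field; rewrite !gt_eqF //; lra.
have p01 : 0 <= p <= 1.
  rewrite divr_ge0 ?(le_trans _ DL_ge1) //=.
  rewrite ler_pdivrMr ?(lt_le_trans _ DL_ge1) //; lra.
have e_le := expR1_le R; have e_ge0 := expR_ge0 (1 : R).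
apply/andP; split; first by apply: sumr_ge0 => A _; apply: ER_weight_ge0.
have mV : (1 < m <= #|V|)%N.
  rewrite m_gt1 -(ler_nat R) (le_trans m_le) // ltW // ln_sublinear //.
  by rewrite ltr0n ltnW.
apply: le_trans (ER_Solve_AE_le (max_degree_gt0 conn V_gt1) p01 mV) _.
have N_le : #|V|%:R <= (10%:R / 3%:R) ^+ m.+1 :> R.
  rewrite NE (le_trans (_ : _ <= expR (m.+1%:R * 1))) //.
    by rewrite mulr1 ler_expR ltW.
  by rewrite expRM_natl lerXn2r ?nnegrE //; lra.
(* Since k <= 2m <= 2 ln N and D p = mu / ln N, k D p <= 2 mu <= 1/15; multiplying by e <= 10/3
   gives 2/9. As 2/9 < 1, the exponent may be lowered to m - 1. *)
have term_le (k : 'I_m.*2) : (m <= k)%N ->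
    #|V|%:R * expR 1 * (expR 1 * (k%:R * (D%:R * p))) ^+ k.-1 <=
    (10%:R / 3%:R) ^+ m.+1 * (10%:R / 3%:R) * (2%:R / 9%:R) ^+ m.-1.
  move=> mk; have km : (k%:R : R) <= 2%:R * L.
    apply: (@le_trans _ _ (m.*2)%:R); first by rewrite ler_nat ltnW.
    by rewrite -mul2n natrM ler_wpM2l.
  have kDp : k%:R * (D%:R * p) <= 15%:R^-1.
    rewrite Dp mulrA ler_pdivrMr //.
    apply: (@le_trans _ _ (2%:R * L * mu)); first by rewrite ler_wpM2r.
    by rewrite -mulrA mulrCA mulrC ler_wpM2r ?(ltW L_gt0) //; lra.
  have kDp_ge0 : 0 <= k%:R * (D%:R * p).
    by case/andP: p01 => p_ge0 _; rewrite mulr_ge0 // mulr_ge0.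
  apply: ler_pM; first by rewrite mulr_ge0.
  - by rewrite exprn_ge0 // mulr_ge0.
  - by apply: ler_pM.
  apply: (@le_trans _ _ ((2%:R / 9%:R) ^+ k.-1)).
    have eDp_le := ler_pM e_ge0 kDp_ge0 e_le kDp.
    apply: lerXn2r; rewrite ?nnegrE; [by rewrite mulr_ge0|lra|].
    by apply: (le_trans eDp_le); lra.
  by apply: ler_wiXn2l; first [lra | rewrite -!subn1 leq_sub2r].
apply: (@le_trans _ _ (\sum_(k < m.*2)
    (10%:R / 3%:R) ^+ m.+1 * (10%:R / 3%:R) * (2%:R / 9%:R) ^+ m.-1)).
  rewrite big_mkcond /=; apply: ler_sum => k _; case: ifP => [/term_le //|_].
  by rewrite !mulr_ge0 ?exprn_ge0 //; lra.
rewrite sumr_const card_ord -[leLHS]mulr_natl -mul2n natrM.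
(* The ratio (10/3)(2/9) = 20/27 splits as (8/9)(5/6): the first factor absorbs m at cost 8, the
   second remains as the decay. The prefactor 100 makes the identity below exact, and 800 = 8 *
   100. *)
have w_ge0 : 0 <= 100%:R * (5%:R / 6%:R) ^+ m :> R.
  by rewrite mulr_ge0 ?exprn_ge0 //; lra.
have := ler_wpM2r w_ge0 (natrM_expn_le R m).
have -> : m%:R * (8%:R / 9%:R) ^+ m * (100%:R * (5%:R / 6%:R) ^+ m) =
   2%:R * m%:R * ((10%:R / 3%:R) ^+ m.+1 * (10%:R / 3%:R)
     * (2%:R / 9%:R) ^+ m.-1) :> R.
  rewrite -(prednK (ltnW m_gt1)) /=; set n := m.-1.
  have c_exp : (8%:R / 9%:R) ^+ n * (5%:R / 6%:R) ^+ n =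
      (10%:R / 3%:R) ^+ n * (2%:R / 9%:R) ^+ n :> R.
    by rewrite -!exprMn; congr (_ ^+ n); lra.
  rewrite !exprS.
  move: (_ ^+ n) (_ ^+ n) (_ ^+ n) (_ ^+ n) c_exp => w z y x c_exp.
  transitivity (n.+1%:R * (2000%:R / 27%:R) * (x * y)); first by field.
  by rewrite c_exp; field.
by move=> /le_trans; apply; rewrite /= mulrA; lra.
Qed.

Local Open Scope classical_set_scope.
Local Open Scope ring_scope.

Theorem theorem1 (R : realType) (V : nat -> finType)
  (Epuz : forall n, {set {set V n}}) (mu : R)
  (hsimple : forall n, simple_graph (Epuz n))
  (hconn : forall n, connected_graph (Epuz n))
  (hN : #|V n| @[n --> \oo] --> \oo)
  (hmu0 : 0 <= mu) (hmu : mu <= 1 / 30) :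
  ER_prob (mu / ((max_degree (Epuz n))%:R * ln #|V n|%:R)) (Solve_AE (Epuz n))
    @[n --> \oo] --> (0 : R).
Proof.
pose m n := Num.trunc (ln #|V n|%:R : R).
have m_cvg : m n @[n --> \oo] --> \oo.
  (* N above e^A forces ln N >= A, hence [m n] >= A. *)
  apply/cvgnyPge => A; move/cvgnyPge: hN => /(_ (Num.trunc (expR A%:R : R)).+1).
  apply: filterS => n hn; rewrite /m truncn_ge_nat; last first.
    by rewrite ln_ge0 // ler1n (leq_ltn_trans _ hn).
  rewrite -ler_expR lnK ?posrE ?ltr0n ?(leq_ltn_trans _ hn) //.
  by apply: ltW; apply: lt_le_trans (truncnS_gt _) _; rewrite ler_nat.
(* The geometric bound holds only eventually, once [m n] is at least 2. *)
apply: (@squeeze_cvgr _ _ _ _ (fun=> 0)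
  (fun n => geometric 800%:R (5%:R / 6%:R) (m n))).
- move/cvgnyPge: (m_cvg) => /(_ 2%N); apply: filterS => n hn.
  by apply: ER_Solve_AE_le_geometric; rewrite ?hmu0.
- exact: cvg_cst.
- apply: (cvg_comp _ _ m_cvg); apply: cvg_geometric.
  by rewrite ger0_norm; lra.
Qed.
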